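(* Let $G$ be a finitely generated abelian group and $\phi:G\to G$ an endomorphism with $R(\phi)<\infty$. Let $\mathrm{Tors}\,G$ be the torsion subgroup of $G$, $G^\infty:=G/\mathrm{Tors}\,G\cong\mathbb{Z}^k$ (so $k=\operatorname{rank} G^\infty$), and let $\phi^{tor}:\mathrm{Tors}\,G\to\mathrm{Tors}\,G$ and $\phi^\infty:G^\infty\to G^\infty$ be the endomorphisms induced by $\phi$. Let $V$ be the complex vector space of all complex-valued functions on $\mathrm{Tors}\,G$ and $A:V\to V$ the linear map $A(h)=h\circ\phi^{tor}$. Let $p$ be the number of eigenvalues $\mu$ of $\phi^\infty$ (viewed as an integer $k\times k$ matrix) with $\mu<-1$, and $r$ the number of real eigenvalues of $\phi^\infty$ with $|\mu|>1$. Then $$R(\phi)=(-1)^{r+p}\sum_{i=0}^{k}(-1)^i\,\mathrm{Tr}\big(\Lambda^i\phi^\infty\otimes A\big),$$ where $\Lambda^i\phi^\infty$ is the $i$-th exterior power of $\phi^\infty\otimes\mathbb{C}$ acting on $\Lambda^i(\mathbb{C}^k)$.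
   Context: For a group $G$ and endomorphism $\phi$, two elements $\alpha,\alpha'\in G$ are $\phi$-conjugate if $\alpha'=\gamma\alpha\phi(\gamma)^{-1}$ for some $\gamma\in G$. The Reidemeister number $R(\phi)$ is the number of $\phi$-conjugacy classes. *)

(* Defs.v *)
From HB Require Import structures.
From mathcomp Require Import all_boot all_order all_algebra all_field.
Set Implicit Arguments. Unset Strict Implicit. Unset Printing Implicit Defensive.
Import Order.TTheory GRing.Theory Num.Theory.
Local Open Scope ring_scope.

Definition fin_gen (G : zmodType) : Prop :=
  exists n (gens : 'I_n -> G), forall g : G,
    exists c : 'I_n -> int, g = \sum_(i < n) gens i *~ c i.

Definition torsion (G : zmodType) (x : G) : Prop :=
  exists m : nat, (0 < m)%N /\ x *+ m = 0.

Definition phi_conj (G : zmodType) (phi : G -> G) (a a' : G) : Prop :=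
  exists g : G, a' = g + a - phi g.

Definition reidemeister_number (G : zmodType) (phi : G -> G) (n : nat) : Prop :=
  exists reps : 'I_n -> G,
    (forall i j, phi_conj phi (reps i) (reps j) -> i = j) /\
    (forall a : G, exists i, phi_conj phi (reps i) a).

Definition tors_enum (G : zmodType) (t : seq G) : Prop :=
  uniq t /\ forall x : G, x \in t <-> torsion x.

Definition basis_mod_tors (G : zmodType) k (e : 'I_k -> G) : Prop :=
  (forall g : G, exists c : 'I_k -> int,
      torsion (g - \sum_(i < k) e i *~ c i)) /\
  (forall c c' : 'I_k -> int,
      torsion (\sum_(i < k) e i *~ c i - \sum_(i < k) e i *~ c' i) -> c = c').

Definition matrix_of_phi_inf (G : zmodType) (phi : G -> G) k (e : 'I_k -> G)
    (M : 'M[int]_k) : Prop :=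
  forall j : 'I_k, torsion (phi (e j) - \sum_(i < k) e i *~ M i j).

(* eigenvalues (with algebraic multiplicity) of a complex square matrix *)
Definition eigenvalues k (M : 'M[algC]_k) : seq algC :=
  sval (closed_field_poly_normal (char_poly M)).

Definition fmx (I J : finType) := I -> J -> algC.
Definition ftrace (I : finType) (f : fmx I I) : algC := \sum_(i : I) f i i.
Definition ftensor (I J I' J' : finType) (f : fmx I J) (g : fmx I' J') :
  fmx (I * I')%type (J * J')%type :=
  fun a b => f a.1 b.1 * g a.2 b.2.

(* i-element subsets of {0,...,k-1}: index the standard basis
   e_{s_1} /\ ... /\ e_{s_i} (s_1 < ... < s_i) of Lambda^i(C^k) *)
Definition ksubset k i := {S : {set 'I_k} | #|S| == i}.

Definition ksub_idx k i (S : ksubset k i) (a : 'I_i) : 'I_k :=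
  enum_val (cast_ord (esym (eqP (valP S))) a).

Definition ext_pow k i (M : 'M[algC]_k) : fmx (ksubset k i) (ksubset k i) :=
  fun S T => \det (\matrix_(a < i, b < i) M (ksub_idx S a) (ksub_idx T b)).

(* matrix of A : h |-> h \o phi^tor on V = (Tors G -> C), in the basis of
   delta functions delta_{t_y}: A(delta_{t_y}) = sum_{x : phi(t_x) = t_y} delta_{t_x} *)
Definition tors_op (G : zmodType) (phi : G -> G) (t : seq G) :
  fmx 'I_(size t) 'I_(size t) :=
  fun x y => (phi (nth 0 t x) == nth 0 t y)%:R.

(* Main.v *)
(* Two elements are phi-conjugate iff they differ by an element of
   (1 - phi)G, so R(phi) is the order of the cokernel of 1 - phi.  If it is
   finite then N = 1 - phi^infty is injective, so the cokernel of 1 - phi is an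
   extension of Z^k / N Z^k, of order |det N| by the Smith normal form, by the
   cokernel of 1 - phi on Tors G, whose order is that of its kernel, the number
   Tr A of fixed points of phi^tor.  Finally det N is the alternating sum of the
   traces of the exterior powers, and it is also the product of the 1 - mu:
   complex eigenvalues pair up with their conjugates, so its sign is -1 to the
   number of real mu > 1, a number congruent to r + p modulo 2. *)

Require Import Defs.
From HB Require Import structures.
From mathcomp Require Import all_boot all_order all_algebra all_field.
Import Order.TTheory GRing.Theory Num.Theory.
Local Open Scope ring_scope.

Set Implicit Arguments.
Unset Strict Implicit.
Unset Printing Implicit Defensive.

(** * Principal minors and traces of exterior powers *)

(** Sylvester's identity: one block matrix has two factorizations into block triangular matrices,
    and the two sides are the resulting values of its determinant. *)
Lemma det_1D_mulmxC (R : comNzRingType) m n (X : 'M[R]_(m, n))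
    (Y : 'M[R]_(n, m)) :
  \det (1%:M + X *m Y) = \det (1%:M + Y *m X).
Proof.
have E1 : block_mx 1%:M (- X) Y 1%:M =
    block_mx 1%:M 0 Y 1%:M *m block_mx 1%:M (- X) 0 (1%:M + Y *m X).
  rewrite mulmx_block !mul1mx !mulmx1 !mul0mx !addr0 mulmxN.
  by rewrite addrC addrK.
have E2 : block_mx 1%:M (- X) Y 1%:M =
    block_mx 1%:M (- X) 0 1%:M *m block_mx (1%:M + X *m Y) 0 Y 1%:M.
  by rewrite mulmx_block !mul1mx !mulmx1 !mul0mx !add0r mulNmx addrK.
have := congr1 determinant E2; rewrite E1 !det_mulmx !det_lblock !det_ublock.
by rewrite !det1 !mul1r !mulr1.
Qed.

(* The matrix with the rows of [B] in [S] and those of [1] elsewhere is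
   [1 + X Y] with [X] the inclusion of the coordinates in [S] and [Y] the
   rows of [B - 1] in [S], while [1 + Y X] is the principal submatrix. *)
Lemma det_rows_principal (R : comNzRingType) k i (B : 'M[R]_k)
    (f : 'I_i -> 'I_k) (S : {set 'I_k}) :
  injective f -> (forall x, x \in S = (x \in codom f)) ->
  \det (\matrix_(x, y) if x \in S then B x y else (x == y)%:R) =
  \det (\matrix_(a, b) B (f a) (f b)).
Proof.
move=> f_inj Sf.
pose X := \matrix_(x < k, a < i) ((x == f a)%:R : R).
pose Y := \matrix_(a < i, y < k) (B (f a) y - (f a == y)%:R).
have -> : (\matrix_(x, y) if x \in S then B x y else (x == y)%:R) =
          1%:M + X *m Y.
  apply/matrixP=> x y; rewrite !mxE; case: ifPn; rewrite Sf.
    case/codomP=> a ->; rewrite (bigD1 a) //= !mxE eqxx mul1r big1 ?addr0.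
      by rewrite addrCA subrr addr0.
    by move=> b nba; rewrite !mxE (inj_eq f_inj) eq_sym (negPf nba) mul0r.
  move=> xf; rewrite big1 ?addr0 // => a _; rewrite !mxE.
  case: eqP => [xa|]; last by rewrite mul0r.
  by case/negP: xf; rewrite xa codom_f.
rewrite det_1D_mulmxC; congr (\det _); apply/matrixP=> a b; rewrite !mxE.
rewrite (bigD1 (f b)) //= !mxE eqxx mulr1 big1 => [|y nyb].
  by rewrite addr0 (inj_eq f_inj) addrC subrK.
by rewrite !mxE (negPf nyb) mulr0.
Qed.

(** Multilinearity in the rows: each row of [1 + B] splits into a row of [B] and a row of [1], and
    [S] records the rows taken from [B]. *)
Lemma det_1D_principal_minors (R : comNzRingType) k (B : 'M[R]_k) :
  \det (1%:M + B) =
  \sum_(S : {set 'I_k})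
     \det (\matrix_(x, y) if x \in S then B x y else (x == y)%:R).
Proof.
rewrite /determinant exchange_big /=; apply: eq_bigr => s _.
rewrite -big_distrr /=; congr (_ * _).
under eq_bigr => i _ do rewrite !mxE addrC.
rewrite bigA_distr; apply: eq_bigr => S _; apply: eq_bigr => x _.
by rewrite mxE.
Qed.

Lemma ftrace_tensor (I J : finType) (f : fmx I I) (g : fmx J J) :
  ftrace (ftensor f g) = ftrace f * ftrace g.
Proof.
rewrite /ftrace /ftensor big_distrlr /= pair_big /=.
by apply: eq_bigr => -[].
Qed.

Lemma ksub_idx_inj k i (S : ksubset k i) : injective (@ksub_idx k i S).
Proof. by move=> a b /enum_val_inj /cast_ord_inj. Qed.

Lemma mem_ksub k i (S : ksubset k i) x :
  (x \in val S) = (x \in codom (@ksub_idx k i S)).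
Proof.
apply/idP/codomP => [xS|[a ->]]; last exact: enum_valP.
exists (cast_ord (eqP (valP S)) (enum_rank_in xS x)).
by rewrite /ksub_idx cast_ordK enum_rankK_in.
Qed.

(** The subsets [S] are grouped by cardinality [i]. The principal minors of [M] of size [i] are the
    diagonal entries of [ext_pow], and replacing [M] by [- M] multiplies them by [(-1) ^+ i]. *)
Lemma det_1B_ext_pow k (M : 'M[algC]_k) :
  \det (1%:M - M) = \sum_(i < k.+1) (-1) ^+ i * ftrace (@ext_pow k i M).
Proof.
rewrite det_1D_principal_minors.
have cardS (S : {set 'I_k}) : (#|S| < k.+1)%N.
  by rewrite ltnS -[k in (_ <= k)%N]card_ord max_card.
rewrite (partition_big (fun S => Ordinal (cardS S)) xpredT) //=.
apply: eq_bigr => i _.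
under eq_bigl => S do rewrite -val_eqE /=.
rewrite big_sub /ftrace big_distrr /=.
apply: eq_bigr => S _.
rewrite (det_rows_principal _ (@ksub_idx_inj _ _ S) (@mem_ksub _ _ S)).
rewrite /ext_pow -detZ.
by congr (\det _); apply/matrixP=> a b; rewrite !mxE mulN1r.
Qed.

(** * Counting cokernels *)

(** For a subgroup [D] stable under [f], the family [v] meets each coset of [f(D)] in [D] exactly
    once. The predicate [D] serves both the whole group and the torsion subgroup; an arbitrary
    finite index type allows pairs as indices. *)
Definition coker_reps (A : zmodType) (D : A -> Prop) (f : A -> A)
    (F : finType) (v : F -> A) :=
  [/\ forall i, D (v i),
      forall i j, (exists2 g, D g & v j - v i = f g) -> i = j
    & forall a, D a -> exists i, exists2 g, D g & a - v i = f g].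

(** Sending each [v i] to the index of its coset in the second system is injective. *)
Lemma coker_reps_leq (A : zmodType) (D : A -> Prop) (f : {additive A -> A})
    (F F' : finType) (v : F -> A) (v' : F' -> A) :
  (forall x y, D x -> D y -> D (x - y)) ->
  coker_reps D f v -> coker_reps D f v' -> (#|F| <= #|F'|)%N.
Proof.
move=> DB [Dv inj_v _] [_ _ sur_v'].
have [h hP] := fin_all_exists (fun i => sur_v' _ (Dv i)).
apply: (@leq_card _ _ h) => i j hij; apply: inj_v.
have [[g Dg vg] [g' Dg' vg']] := (hP i, hP j).
exists (g' - g); first exact: DB.
by rewrite raddfB /= -vg -vg' hij opprB addrA subrK.
Qed.

Lemma coker_reps_card (A : zmodType) (D : A -> Prop) (f : {additive A -> A})
    (F F' : finType) (v : F -> A) (v' : F' -> A) :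
  (forall x y, D x -> D y -> D (x - y)) ->
  coker_reps D f v -> coker_reps D f v' -> #|F| = #|F'|.
Proof.
move=> DB v_reps v'_reps; apply/eqP; rewrite eqn_leq.
by rewrite (coker_reps_leq DB v_reps v'_reps)
           (coker_reps_leq DB v'_reps v_reps).
Qed.

Lemma absz_det_unitmx k (L : 'M[int]_k) : L \in unitmx -> `|\det L|%N = 1%N.
Proof. by rewrite unitmxE unfold_in => /orP[]/eqP->. Qed.

(** With the Smith form [N = L D R], multiplication by [L] identifies the cokernel of [D], the
    product of the [Z / d_i], with that of [N]. *)
Lemma coker_reps_int_mx k (N : 'M[int]_k) : \det N != 0 ->
  exists (F : finType) (v : F -> 'cV[int]_k),
    #|F| = `|\det N|%N /\ coker_reps (fun=> True) (mulmx N) v.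
Proof.
move=> detN; have [L uL [R uR [d _ defN]]] := int_Smith_normal_form N.
set D := \matrix_(i, j) _ in defN.
have defD : D = diag_mx (\row_i d`_i) by apply/matrixP=> i j; rewrite !mxE.
have Dmul (c : 'cV_k) i : (D *m c) i 0 = d`_i * c i 0.
  by rewrite defD mul_diag_mx !mxE.
have absN : `|\det N|%N = (\prod_(i < k) `|(d`_i)%R|)%N.
  rewrite defN !det_mulmx !abszM (absz_det_unitmx uL) (absz_det_unitmx uR).
  rewrite mul1n muln1.
  rewrite defD det_diag (big_morph absz abszM (erefl _)).
  by apply: eq_bigr => i _; rewrite mxE.
have d_neq0 (i : 'I_k) : d`_i != 0.
  apply: contraNneq detN => di0; rewrite -absz_eq0 absN.
  by rewrite (bigD1 i) //= di0 mul0n.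
pose F : finType := {dffun forall i : 'I_k, 'I_(`|(d`_i)%R|)}.
pose v (u : F) : 'cV[int]_k := L *m \col_i (u i : nat)%:Z.
exists F, v; split.
  rewrite card_dep_ffun absN foldrE big_map big_enum /=.
  by apply: eq_bigr => i _; rewrite card_ord.
split=> // [u u' [g _]|a _].
  rewrite /v -mulmxBr defN -!mulmxA => /(congr1 (mulmx (invmx L))).
  rewrite !mulKmx // => uu'; apply/ffunP=> i; apply/val_inj=> /=.
  have := congr1 (fun c : 'cV_k => c i 0) uu'; rewrite /= Dmul !mxE => uu'i.
  have: (`|(d`_i)%R|%N %| (u' i)%:Z - (u i)%:Z)%Z.
    by rewrite uu'i dvdzE abszM dvdn_mulr.
  rewrite -eqz_mod_dvd !modz_nat eqz_nat.
  by rewrite !modn_small ?ltn_ord // => /eqP.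
pose b i : int := (invmx L *m a) i 0.
have ltd (i : 'I_k) : (`|(b i %% (d`_i)%R)%Z| < `|(d`_i)%R|)%N.
  by rewrite -ltz_nat !abszE ger0_norm ?modz_ge0 // ltz_mod.
pose u : F := [ffun i => Ordinal (ltd i)].
(* In the coordinates [b = L^-1 a], the remainders modulo the [d_i] give the representative, and the
   quotients, pulled back through [R], give the preimage of the difference. *)
exists u, (invmx R *m \col_i (b i %/ d`_i)%Z) => //.
rewrite defN -!mulmxA mulKVmx // /v -{1}[a](mulKVmx uL) -mulmxBr.
congr (L *m _); apply/colP=> i; rewrite Dmul mxE -/(b i) mxE [in RHS]mxE.
rewrite mxE ffunE /= abszE ger0_norm ?modz_ge0 //.
by rewrite {1}(divz_eq (b i) d`_i) addrK mulrC.
Qed.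

(** The order of the finite group [t] is both [|coker| * |im|] and [|im| * |ker|]; cancelling [|im|]
    leaves [|coker| = |ker|]. *)
Lemma coker_reps_finite (A : zmodType) (f : {additive A -> A}) (t : seq A) :
  uniq t -> 0 \in t -> {in t &, forall x y, x - y \in t} ->
  {in t, forall x, f x \in t} ->
  exists (F : finType) (v : F -> A),
    #|F| = count (fun x => f x == 0) t /\ coker_reps (fun x => x \in t) f v.
Proof.
move=> t_uniq t0 tB tf.
have tN x : x \in t -> - x \in t by move=> tx; rewrite -sub0r tB.
have tD x y : x \in t -> y \in t -> x + y \in t.
  by move=> tx ty; rewrite -[y]opprK tB ?tN.
pose T : finType := seq_sub t.
pose fT (x : T) : T := SeqSub (tf _ (valP x)).
pose addT (x y : T) : T := SeqSub (tD _ _ (valP x) (valP y)).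
have addTI x : injective (addT x).
  by move=> y z /(congr1 val) /= /addrI /val_inj.
pose I := [set fT x | x in T].
pose K := [set x | fT x == SeqSub t0].
pose rel_im (x y : T) := [exists g : T, val y - val x == f (val g)].
have rel_imP x y :
    reflect (exists2 g, g \in t & val y - val x = f g) (rel_im x y).
  apply: (iffP existsP) => [[g /eqP xy]|[g tg xy]].
    by exists (val g); rewrite ?(valP g).
  by exists (SeqSub tg); apply/eqP.
have rel_im_equiv x y z :
    rel_im x x /\ (rel_im x y -> rel_im x z = rel_im y z).
  split; first by apply/rel_imP; exists 0; rewrite // subrr raddf0.
  move=> /rel_imP[g tg xy]; apply/rel_imP/rel_imP => -[h th hz].
    by exists (h - g); rewrite ?tB // raddfB -hz -xy opprB addrA subrK.
  by exists (h + g); rewrite ?tD // raddfD -hz -xy addrA subrK.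
(* A canonical element of the coset of [x]. The default is never reached since [rel_im] is
   reflexive, and equal cosets yield the same pick, so the fixed points of [c] index the
   cokernel. *)
pose c x := odflt x [pick y | rel_im x y].
have c_rel x : rel_im x (c x).
  rewrite /c; case: pickP => [y //|/(_ x)].
  by rewrite (rel_im_equiv x x x).1.
have rel_sym x y : rel_im x y = rel_im y x.
  by apply/idP/idP => /[dup] /(rel_im_equiv _ _ _).2 <-;
     rewrite (rel_im_equiv _ _ _).1.
have cE x y : (c x == c y) = rel_im x y.
  apply/eqP/idP => [cxy|xy].
    by rewrite ((rel_im_equiv _ _ _).2 (c_rel x)) cxy rel_sym.
  have eq_rel : rel_im x =1 rel_im y by move=> z; exact: (rel_im_equiv _ _ _).2.
  rewrite /c (eq_pick eq_rel); case: pickP => [//|/(_ x)].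
  by rewrite rel_sym xy.
have cc x : c (c x) = c x by apply/eqP; rewrite cE rel_sym.
have cardT_coker : #|T| = (#|[set x | c x == x]| * #|I|)%N.
  rewrite -[LHS]sum1_card.
  rewrite (partition_big c [in [set x | c x == x]]) /=; last first.
    by move=> x _; rewrite inE cc.
  rewrite -sum_nat_const; apply: eq_bigr => x; rewrite inE => /eqP cx.
  (* The fibre of [c] over its fixed point [x] is the translate [x + I]. *)
  rewrite sum1dep_card -(card_imset I (addTI x)).
  apply: eq_card => y; rewrite inE -{1}cx cE rel_sym.
  apply/rel_imP/imsetP => [[g tg xy]|[_ /imsetP[g _ ->] ->]].
    exists (fT (SeqSub tg)); first exact: imset_f.
    by apply/val_inj; rewrite /= -xy addrC subrK.
  by exists (val g); rewrite ?(valP g) //= addrC addKr.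
have cardT_im : #|T| = (#|I| * #|K|)%N.
  rewrite -[LHS]sum1_card (partition_big fT [in I]) /=; last first.
    by move=> x _; exact: imset_f.
  rewrite -sum_nat_const; apply: eq_bigr => _ /imsetP[x _ ->].
  (* The fibre of [fT] through [x] is the translate [x + K]. *)
  rewrite sum1dep_card -(card_imset K (addTI x)).
  apply: eq_card => y; rewrite inE; apply/eqP/imsetP => [fyx|[z]].
    exists (SeqSub (tB _ _ (valP y) (valP x))).
      rewrite inE; apply/eqP/val_inj; rewrite /= raddfB.
      by move/(congr1 val): fyx => /= ->; rewrite subrr.
    by apply/val_inj; rewrite /= addrC subrK.
  rewrite inE => /eqP/(congr1 val) /= fz ->.
  by apply/val_inj; rewrite /= raddfD /= fz addr0.
exists {x | c x == x}, (fun x => val (val x)); split.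
  have -> : count (fun x => f x == 0) t = #|K|.
    rewrite -[t in count _ t](val_seq_sub_enum t_uniq) count_map.
    by rewrite cardsE cardE /enum_mem unlock size_filter.
  have -> : #|{: {x : T | c x == x}}| = #|[set x | c x == x]|.
    by rewrite card_sig cardsE.
  have I_gt0 : (0 < #|I|)%N.
    by apply/card_gt0P; exists (fT (SeqSub t0)); exact: imset_f.
  by apply/eqP; rewrite -(eqn_pmul2r I_gt0) -cardT_coker cardT_im mulnC.
split=> [x|x y xy|a ta].
- exact: valP.
- apply/val_inj; rewrite -(eqP (valP x)) -(eqP (valP y)); apply/eqP.
  by rewrite cE; apply/rel_imP.
have cca : c (c (SeqSub ta)) == c (SeqSub ta) by rewrite cc.
exists (exist (fun x : T => c x == x) _ cca).
by apply/(rel_imP _ (SeqSub ta)); rewrite rel_sym.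
Qed.

(** * The sign of the determinant of [1 - M] *)

Lemma horner_char_poly (R : comNzRingType) k (A : 'M[R]_k) a :
  (char_poly A).[a] = \det (a%:M - A).
Proof.
rewrite -horner_evalE -det_map_mx; congr (\det _); apply/matrixP=> i j.
by rewrite !mxE /= horner_evalE !hornerE hornerMn hornerX.
Qed.

(* The factors [1 - z] and [1 - z^*] of a conjugate pair multiply to a
   nonnegative number, so only the real [z > 1] contribute signs. *)
Lemma sign_prod_1B_ge0 (s : seq algC) :
  perm_eq [seq z^* | z <- s] s ->
  0 <= (-1) ^+ count (fun z => 1 < z) s * \prod_(z <- s) (1 - z).
Proof.
move=> s_conj; rewrite (bigID (fun z : algC => z \is Num.real)) /= mulrA.
apply: mulr_ge0.
  elim: s {s_conj} => [|z s IHs]; first by rewrite big_nil mulr1.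
  rewrite big_cons /=; case: (boolP (1 < z)) => [z_gt1|z_le1].
    rewrite gtr0_real ?(lt_trans ltr01 z_gt1) // add1n exprS.
    rewrite mulN1r mulNr -mulrN mulrC -mulNr opprB -mulrA mulr_ge0 //.
      by rewrite subr_ge0 ltW.
    by rewrite mulrC.
  case: ifP => [z_real|_]; rewrite add0n // mulrCA mulr_ge0 // subr_ge0.
  by rewrite real_leNgt.
rewrite (bigID (fun z : algC => 0 < 'Im z)) /=.
set X := \prod_(z <- s | _) _.
(* Conjugation exchanges the non-real members of [s] in the upper and lower half planes, so the
   lower product is the conjugate of the upper one. *)
suff -> : \prod_(z <- s | (z \isn't Num.real) && ~~ (0 < 'Im z)) (1 - z) = X^*.
  exact: mul_conjC_ge0.
rewrite -(perm_big _ s_conj) big_map /X rmorph_prod.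
apply: eq_big => [z|z _]; last by rewrite rmorphB rmorph1.
have -> : (z^* \is Num.real) = (z \is Num.real).
  by rewrite !CrealE conjCK eq_sym.
apply: andb_id2l => z_nreal.
rewrite Im_conj oppr_gt0 -real_leNgt ?real0 ?Creal_Im // le0r.
by case: eqP => // /Creal_ImP; rewrite (negPf z_nreal).
Qed.

(** The characteristic polynomial has integer coefficients, so conjugation fixes it and permutes its
    roots with their multiplicities. *)
Lemma eigenvalues_int_conj k (M : 'M[int]_k) :
  let s := eigenvalues (map_mx (intr : int -> algC) M) in
  perm_eq [seq z^* | z <- s] s.
Proof.
set MC := map_mx _ M; rewrite /eigenvalues.
case: closed_field_poly_normal => s /= def_s; apply: prod_XsubC_eq.
move: def_s; rewrite (monicP (char_poly_monic _)) scale1r => def_s.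
have conj_s : map_poly Num.conj (char_poly MC) = char_poly MC.
  rewrite map_char_poly -map_mx_comp; congr char_poly.
  by apply: eq_map_mx => z /=; rewrite rmorph_int.
rewrite -def_s -conj_s def_s rmorph_prod big_map.
by apply: eq_bigr => z _; rewrite rmorphB /= map_polyX map_polyC.
Qed.

Lemma sign_det_1B k (M : 'M[int]_k) :
  let MC := map_mx (intr : int -> algC) M in
  let p := count (fun mu : algC => mu < -1) (eigenvalues MC) in
  let r := count (fun mu : algC => (mu \is Num.real) && (1 < `|mu|))
                 (eigenvalues MC) in
  (-1) ^+ (r + p) * \det (1%:M - MC) = (`|\det (1%:M - M)|%N)%:R.
Proof.
move=> MC p r; set s := eigenvalues MC in p r *.
pose q := count (fun z : algC => 1 < z) s.
have -> : (-1) ^+ (r + p) = (-1) ^+ q :> algC.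
  (* A real [z] with [|z| > 1] satisfies either [z > 1] or [z < -1]; then [r + p = q + 2p] has the
     parity of [q]. *)
  suff -> : r = (q + p)%N.
    by rewrite -addnA exprD addnn -muln2 exprM sqrr_sign mulr1.
  rewrite -count_predUI.
  rewrite (@eq_count _ (predI _ _) pred0) ?count_pred0 ?addn0; last first.
    move=> z /=; apply/negP=> /andP[z_gt1 /(lt_trans z_gt1)].
    by move=> /lt_gtF; rewrite (lt_trans (ltrN10 _) ltr01).
  apply: eq_count => z /=.
  case: (boolP (z \is Num.real)) => [z_real|z_nreal] /=.
    by rewrite real_ltr_normr // ltrNr.
  apply/esym/negP=> /orP[] z1; case/negP: z_nreal.
    by rewrite gtr0_real // (lt_trans ltr01).
  by rewrite ltr0_real // (lt_trans z1) // ltrN10.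
have detE : \det (1%:M - MC) = \prod_(z <- s) (1 - z).
  rewrite -horner_char_poly /s /eigenvalues.
  case: closed_field_poly_normal => s' /= ->.
  rewrite (monicP (char_poly_monic _)) scale1r horner_prod.
  by apply: eq_bigr => z _; rewrite !hornerE.
have det_int : \det (1%:M - MC) = (\det (1%:M - M))%:~R.
  by rewrite -det_map_mx map_mxB map_mx1.
(* The signed determinant is nonnegative, hence equal to its norm, where the sign disappears. *)
rewrite -[LHS]ger0_norm; last first.
  rewrite detE; apply: sign_prod_1B_ge0; exact: eigenvalues_int_conj.
by rewrite normrMsign det_int -intr_norm -abszE.
Qed.

(** * Torsion elements and coordinates modulo torsion *)

Lemma torsionB (G : zmodType) (x y : G) :
  torsion x -> torsion y -> torsion (x - y).
Proof.
move=> [m [m_gt0 xm]] [n [n_gt0 yn]]; exists (m * n)%N.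
split; first by rewrite muln_gt0 m_gt0.
by rewrite mulrnBl mulrnA xm mul0rn mulnC mulrnA yn mul0rn subr0.
Qed.

Lemma torsion0 (G : zmodType) : torsion (0 : G).
Proof. by exists 1%N; rewrite mul0rn. Qed.

Lemma torsionN (G : zmodType) (x : G) : torsion x -> torsion (- x).
Proof. by rewrite -sub0r; exact: torsionB (torsion0 G). Qed.

Lemma torsionD (G : zmodType) (x y : G) :
  torsion x -> torsion y -> torsion (x + y).
Proof. by move=> tx /torsionN ty; rewrite -[y]opprK; exact: torsionB. Qed.

Lemma torsion_trans (G : zmodType) (x y z : G) :
  torsion (x - y) -> torsion (y - z) -> torsion (x - z).
Proof. by move=> xy yz; rewrite -(subrKA y); exact: torsionD. Qed.

Lemma torsion_sum (G : zmodType) k (x : 'I_k -> G) :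
  (forall i, torsion (x i)) -> torsion (\sum_i x i).
Proof.
move=> tx; elim/big_ind: _ => // [|y z]; [exact: torsion0 | exact: torsionD].
Qed.

Lemma torsionMz (G : zmodType) (x : G) m : torsion x -> torsion (x *~ m).
Proof.
by move=> [n [n_gt0 xn]]; exists n; rewrite pmulrn mulrzAC -pmulrn xn mul0rz.
Qed.

Lemma torsion_raddf (G H : zmodType) (f : {additive G -> H}) (x : G) :
  torsion x -> torsion (f x).
Proof. by move=> [m [m_gt0 xm]]; exists m; rewrite -raddfMn xm raddf0. Qed.

Section TorsionFreeQuotient.

Variables (G : zmodType) (phi : {additive G -> G}) (k : nat) (e : 'I_k -> G).
Variable M : 'M[int]_k.
Hypotheses (e_basis : basis_mod_tors e) (phiM : matrix_of_phi_inf phi e M).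

Definition lin_comb (c : 'cV[int]_k) : G := \sum_(i < k) e i *~ c i 0.

Lemma lin_combB c d : lin_comb (c - d) = lin_comb c - lin_comb d.
Proof. by rewrite -sumrB; apply: eq_bigr => i _; rewrite !mxE mulrzBr. Qed.

Lemma lin_comb_surj g : exists c, torsion (g - lin_comb c).
Proof.
have [c gc] := e_basis.1 g; exists (\col_i c i).
by rewrite /lin_comb; under eq_bigr do rewrite mxE.
Qed.

Lemma lin_comb_inj c d : torsion (lin_comb c - lin_comb d) -> c = d.
Proof.
by move=> /e_basis.2 cd; apply/colP=> i; apply: (congr1 (@^~ i) cd).
Qed.

Lemma phi_lin_comb c : torsion (phi (lin_comb c) - lin_comb (M *m c)).
Proof.
have -> : lin_comb (M *m c) = \sum_j (\sum_i e i *~ M i j) *~ c j 0.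
  rewrite /lin_comb.
  under [RHS]eq_bigr do rewrite mulrz_suml.
  rewrite exchange_big; apply: eq_bigr => i _ /=.
  by rewrite mxE mulrz_sumr; apply: eq_bigr => j _; rewrite mulrzA.
rewrite raddf_sum -sumrB; apply: torsion_sum => j.
by rewrite raddfMz -mulrzBl; apply: torsionMz; exact: phiM.
Qed.

Definition id_sub_phi (g : G) : G := g - phi g.

Fact id_sub_phi_is_zmod_morphism : zmod_morphism id_sub_phi.
Proof.
move=> x y; rewrite /id_sub_phi raddfB /= !opprB addrACA [RHS]addrACA.
by rewrite [- y + _]addrC.
Qed.

HB.instance Definition _ := GRing.isZmodMorphism.Build G G id_sub_phi
  id_sub_phi_is_zmod_morphism.

Lemma id_sub_phi_lin_comb c :
  torsion (id_sub_phi (lin_comb c) - lin_comb ((1%:M - M) *m c)).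
Proof.
rewrite mulmxBl mul1mx lin_combB /id_sub_phi opprB addrC addrA subrK.
by rewrite -opprB; apply/torsionN/phi_lin_comb.
Qed.

(** Modulo torsion, [1 - phi] acts on coordinates as [1 - M], and coordinates are unique. *)
Lemma id_sub_phi_coords g c d :
  torsion (g - lin_comb d) -> torsion (id_sub_phi g - lin_comb c) ->
  c = (1%:M - M) *m d.
Proof.
move=> /(torsion_raddf id_sub_phi); rewrite raddfB /= => gd gc.
apply: lin_comb_inj.
move/torsionN: gc; rewrite opprB => gc.
exact: torsion_trans (torsion_trans gc gd) (id_sub_phi_lin_comb d).
Qed.

(** If the determinant vanished, a nonzero row [w] would kill the image of [1 - M]. Choosing [w_i]
    nonzero, the multiples of the [i]-th basis vector would take distinct values under [w], hence
    lie in infinitely many cosets. *)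
Lemma coker_reps_det_neq0 (F : finType) (v : F -> G) :
  coker_reps (fun=> True) id_sub_phi v -> \det (1%:M - M) != 0.
Proof.
move=> [_ _ v_surj]; apply/negP => /det0P[w w_neq0 wN].
have /rV0Pn[i wi] := w_neq0.
pose a (m : nat) : 'cV[int]_k := m%:Z *: delta_mx i 0.
have [h hP] := fin_all_exists (fun m : 'I_#|F|.+1 => v_surj (lin_comb (a m)) I).
(* Pigeonhole: [#|F| + 1] multiples are distributed among [#|F|] cosets. *)
have /injectivePn[m [m' neq_mm' hmm']] : ~~ injectiveb h.
  by apply/negP=> /injectiveP/leq_card; rewrite card_ord ltnn.
have [[g _ vg] [g' _ vg']] := (hP m, hP m').
have [d gd] := lin_comb_surj (g - g').
have /(congr1 (mulmx w)) : a m - a m' = (1%:M - M) *m d.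
  apply: (id_sub_phi_coords gd).
  rewrite raddfB /= -vg -vg' hmm' opprB addrA subrK lin_combB subrr.
  exact: torsion0.
rewrite mulmxA wN mul0mx -scalerBl -scalemxAr -colE.
move=> /(congr1 (fun x : 'M_1 => x 0 0)); rewrite !mxE => /eqP.
rewrite mulf_eq0 (negPf wi) orbF subr_eq0 eqz_nat => /eqP/val_inj mm'.
by rewrite mm' eqxx in neq_mm'.
Qed.

(** The cokernel on [G] is an extension of the cokernel on coordinates by the one on torsion.
    Injectivity of [1 - M] ensures that torsion elements congruent modulo [(1 - phi) G] are already
    congruent modulo the image of the torsion subgroup. *)
Lemma coker_reps_assemble (t : seq G) (F1 F2 : finType)
    (v1 : F1 -> 'cV[int]_k) (v2 : F2 -> G) :
  tors_enum t -> \det (1%:M - M) != 0 ->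
  coker_reps (fun=> True) (mulmx (1%:M - M)) v1 ->
  coker_reps (fun x => x \in t) id_sub_phi v2 ->
  coker_reps (fun=> True) id_sub_phi
    (fun ij : F1 * F2 => lin_comb (v1 ij.1) + v2 ij.2).
Proof.
move=> [_ tP] detN [_ v1_inj v1_surj] [v2_t v2_inj v2_surj].
have v2_tors j : torsion (v2 j) by apply/tP.
split=> // [[i j] [i' j'] /= [g _ vg] | a _].
  have [d gd] := lin_comb_surj g.
  have Nd : v1 i' - v1 i = (1%:M - M) *m d.
    apply: (id_sub_phi_coords gd); rewrite -vg lin_combB.
    by rewrite [- (_ + v2 j)]opprD addrACA addrC addrK; exact: torsionB.
  have ii' : i = i' by apply: v1_inj; exists d.
  have d0 : d = 0.
    (* Over the integers [1 - M] need not be invertible; its adjugate suffices to cancel it. *)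
    move: Nd; rewrite ii' subrr => /(congr1 (mulmx (\adj (1%:M - M)))).
    rewrite mulmx0 mulmxA mul_adj_mx mul_scalar_mx => /esym/eqP.
    by rewrite scalemx_eq0 (negPf detN) => /eqP.
  congr (_, _) => //; apply: v2_inj; exists g.
    by apply/tP; move: gd; rewrite d0 -[0](subrr 0) lin_combB subrr subr0.
  by rewrite -vg ii' opprD addrACA subrr add0r.
have [c ac] := lin_comb_surj a.
have [i [d _ cd]] := v1_surj c I.
(* Since [c = v1 i + (1 - M) d], removing the lift of [v1 i] and the image of the lift of [d] leaves
   a torsion remainder, which [v2] represents. *)
have tx : a - lin_comb (v1 i) - id_sub_phi (lin_comb d) \in t.
  apply/tP; have := torsionB ac (id_sub_phi_lin_comb d).
  by rewrite -cd lin_combB opprB addrA subrKA.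
have [j [h _ xh]] := v2_surj _ tx.
exists (i, j), (lin_comb d + h) => //=.
by rewrite [RHS]raddfD /= -xh addrA [_ + (_ - _)]addrC subrK opprD addrA.
Qed.

End TorsionFreeQuotient.

(** * Fixed points on torsion and the final count *)

(** A diagonal entry is 1 exactly at a fixed point; fixed points are written as zeros of [1 - phi]
    to match the kernel count. *)
Lemma ftrace_tors_op (G : zmodType) (phi : G -> G) (t : seq G) :
  ftrace (@tors_op G phi t) = (count (fun x => x - phi x == 0) t)%:R.
Proof.
rewrite -sum1_count big_mkcond natr_sum /= (big_nth 0) big_mkord.
apply: eq_bigr => i _; rewrite /tors_op subr_eq0 eq_sym.
by case: eqP.
Qed.

Theorem theorem1 (G : zmodType) (phi : {additive G -> G}) (n : nat)
    (t : seq G) (k : nat) (e : 'I_k -> G) (M : 'M[int]_k) :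
  fin_gen G ->
  reidemeister_number phi n ->
  tors_enum t ->
  basis_mod_tors e ->
  matrix_of_phi_inf phi e M ->
  let MC := map_mx (intr : int -> algC) M in
  let p := count (fun mu : algC => mu < -1) (eigenvalues MC) in
  let r := count (fun mu : algC => (mu \is Num.real) && (1 < `|mu|))
                 (eigenvalues MC) in
  (n%:R : algC) =
    (-1) ^+ (r + p) *
    \sum_(i < k.+1) (-1) ^+ i * ftrace (ftensor (@ext_pow k i MC) (@tors_op G phi t)).
Proof.
move=> _ [reps [reps_inj reps_surj]] [t_uniq tP] e_basis phiM MC p r.
have phi_conjP a a' :
    phi_conj phi a a' <-> exists2 g, True & a' - a = id_sub_phi phi g.
  split=> [[g ->]|[g _ a'a]]; exists g => //.
    by rewrite addrAC addrK.
  by rewrite addrAC -/(id_sub_phi phi g) -a'a subrK.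
have repsP : coker_reps (fun=> True) (id_sub_phi phi) reps.
  split=> // [i j ij|a _]; first by apply: reps_inj; apply/phi_conjP.
  by have [i /phi_conjP ia] := reps_surj a; exists i.
have detN := coker_reps_det_neq0 e_basis phiM repsP.
have [F1 [v1 [cardF1 v1P]]] := coker_reps_int_mx detN.
have tB : {in t &, forall x y, x - y \in t}.
  by move=> x y /tP tx /tP ty; apply/tP; exact: torsionB.
have t0 : 0 \in t by apply/tP; exact: torsion0.
have tf : {in t, forall x, id_sub_phi phi x \in t}.
  by move=> x /tP tx; apply/tP; exact: torsion_raddf.
have [F2 [v2 [cardF2 v2P]]] := coker_reps_finite t_uniq t0 tB tf.
have := coker_reps_assemble e_basis phiM (conj t_uniq tP) detN v1P v2P.
(* Both systems represent the cokernel of [1 - phi] on [G], so [n] is the product of the two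
   cokernel orders. *)
move/(coker_reps_card (fun _ _ _ _ => I) repsP).
rewrite card_ord card_prod cardF1 cardF2 => ->.
(* The trace of a tensor product is multiplicative, so the trace of [A] factors out and the
   remaining sum is the determinant of [1 - MC]. *)
under eq_bigr do rewrite ftrace_tensor mulrA.
rewrite -mulr_suml -det_1B_ext_pow mulrA sign_det_1B ftrace_tors_op.
by rewrite natrM.
Qed.
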